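(* Let $(A,B)$ be a metric $3$-Lie algebra over $F$, let $D\in Der_B(A)$ be invertible, and let $\delta\in Der_B(A)$ satisfy $\delta([A,A,A])=0$ and $$\delta D-D\delta=2\delta .$$ Let $b=Fe_1+Fe_2$ be the $2$-dimensional $3$-Lie algebra (with zero bracket), and let $(\tilde A=b\oplus A\oplus b^*,T)$ be the double extension of $A$ by means of $\delta$. Then the linear endomorphism $\tilde D$ of $\tilde A$ defined by $$\tilde D|_A=D,\qquad \tilde D e_i=-e_i,\qquad \tilde D e_i^*=e_i^*,\qquad i=1,2,$$ is an invertible derivation of the $3$-Lie algebra $\tilde A$, and $\tilde D\in Der_T(\tilde A)$.
   Context: $F$ is an algebraically closed field of characteristic zero. A $3$-Lie algebra over $F$ is an $F$-vector space $L$ with a trilinear, totally skew-symmetric bracket satisfying $[[x_1,x_2,x_3],y_2,y_3]=[[x_1,y_2,y_3],x_2,x_3]+[x_1,[x_2,y_2,y_3],x_3]+[x_1,x_2,[x_3,y_2,y_3]]$ for all elements. A derivation is a linear map $D$ with $D[x,y,z]=[Dx,y,z]+[x,Dy,z]+[x,y,Dz]$. A metric on $L$ is a non-degenerate symmetric bilinear form $B$ with $B([x_1,x_2,x_3],x_4)+B(x_3,[x_1,x_2,x_4])=0$ for all $x_i\in L$; then $(L,B)$ is a metric $3$-Lie algebra and $Der_B(L)$ is the set of derivations $D$ of $L$ with $B(Dx,y)+B(x,Dy)=0$ for all $x,y$. Double extension. Let $(A,B)$ be a metric $3$-Lie algebra, $\delta\in Der_B(A)$ with $\delta([A,A,A])=0$,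 $b=Fe_1+Fe_2$ the two-dimensional $3$-Lie algebra, and $b^*$ its dual with dual basis $e_1^*,e_2^*$, $e_i^*(e_j)=\delta_{ij}$ (Kronecker delta). Let $\psi:b\wedge b\to End(A)$ be the linear map with $\psi(e_1,e_2)=\delta$, and define $\phi:A\otimes A\otimes b\to b^*$ by $\phi(x_1,x_2,y)(z)=B(\psi(y,z)x_1,x_2)$ for $x_1,x_2\in A$, $y,z\in b$. The double extension of $A$ by means of $\delta$ is the metric $3$-Lie algebra $(\tilde A,T)$ with $\tilde A=b\oplus A\oplus b^*$, bracket, for $y_i\in b$, $x_i\in A$, $f_i\in b^*$, $$[y_1+x_1+f_1,y_2+x_2+f_2,y_3+x_3+f_3]=[x_1,x_2,x_3]_A+\psi(y_2,y_3)x_1-\psi(y_1,y_3)x_2+\psi(y_1,y_2)x_3$$ $$\qquad+\phi(x_1,x_2,y_3)-\phi(x_1,x_3,y_2)+\phi(x_2,x_3,y_1),$$ and metric $T(y_1+x_1+f_1,y_2+x_2+f_2)=B(x_1,x_2)+f_1(y_2)+f_2(y_1)$. *)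

(* Defs.v *)
From HB Require Import structures.
From mathcomp Require Import all_boot all_order all_algebra.
From mathcomp Require Import ring.

Set Implicit Arguments.
Unset Strict Implicit.
Unset Printing Implicit Defensive.

Import GRing.Theory.
Local Open Scope ring_scope.

(* No finite-dimensionality is assumed.  Skew-symmetry is required for the two
   adjacent transpositions, which generate the symmetric group. *)
HB.mixin Record isLie3 (F : fieldType) L of GRing.Lmodule F L := {
  br3 : L -> L -> L -> L;
  br3_linear1 : forall y z, linear (fun x => br3 x y z);
  br3_linear2 : forall x z, linear (fun y => br3 x y z);
  br3_linear3 : forall x y, linear (fun z => br3 x y z);
  br3_skew12 : forall x y z, br3 y x z = - br3 x y z;
  br3_skew23 : forall x y z, br3 x z y = - br3 x y z;
  br3_fundamental : forall x1 x2 x3 y2 y3,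
    br3 (br3 x1 x2 x3) y2 y3 =
      br3 (br3 x1 y2 y3) x2 x3 + br3 x1 (br3 x2 y2 y3) x3
      + br3 x1 x2 (br3 x3 y2 y3)
}.

#[short(type="lie3Type")]
HB.structure Definition Lie3 (F : fieldType) :=
  { L of isLie3 F L & GRing.Lmodule F L }.

Notation "[lie x , y , z ]" := (br3 x y z)
  (at level 0, x, y, z at level 99, format "[lie  x ,  y ,  z ]") : ring_scope.

Section Lie3Defs.
Variables (F : fieldType) (L : lie3Type F).

Definition is_derivation (D : {linear L -> L}) : Prop :=
  forall x y z,
    D [lie x, y, z] = [lie D x, y, z] + [lie x, D y, z] + [lie x, y, D z].

Record is_metric (B : {biscalar L}) : Prop := IsMetric {
  metric_sym : forall x y, B x y = B y x;
  metric_nondeg : forall x, (forall y, B x y = 0) -> x = 0;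
  metric_inv : forall x1 x2 x3 x4,
    B [lie x1, x2, x3] x4 + B x3 [lie x1, x2, x4] = 0
}.

(* Membership in Der_B(L). *)
Definition is_Der (B : {biscalar L}) (D : {linear L -> L}) : Prop :=
  is_derivation D /\ forall x y, B (D x) y + B x (D y) = 0.

Lemma br3D1 x x' y z : [lie x + x', y, z] = [lie x, y, z] + [lie x', y, z] :> L.
Proof. by have:= br3_linear1 y z 1 x x'; rewrite !scale1r. Qed.
Lemma br3D2 x y y' z : [lie x, y + y', z] = [lie x, y, z] + [lie x, y', z] :> L.
Proof. by have:= br3_linear2 x z 1 y y'; rewrite !scale1r. Qed.
Lemma br3D3 x y z z' : [lie x, y, z + z'] = [lie x, y, z] + [lie x, y, z'] :> L.
Proof. by have:= br3_linear3 x y 1 z z'; rewrite !scale1r. Qed.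

Lemma br3_01 y z : [lie 0, y, z] = 0 :> L.
Proof. by apply: (addrI [lie 0, y, z]); rewrite -br3D1 !addr0. Qed.
Lemma br3_02 x z : [lie x, 0, z] = 0 :> L.
Proof. by apply: (addrI [lie x, 0, z]); rewrite -br3D2 !addr0. Qed.
Lemma br3_03 x y : [lie x, y, 0] = 0 :> L.
Proof. by apply: (addrI [lie x, y, 0]); rewrite -br3D3 !addr0. Qed.

Lemma br3Z1 a x y z : [lie a *: x, y, z] = a *: [lie x, y, z] :> L.
Proof. by have:= br3_linear1 y z a x 0; rewrite br3_01 !addr0. Qed.
Lemma br3Z2 a x y z : [lie x, a *: y, z] = a *: [lie x, y, z] :> L.
Proof. by have:= br3_linear2 x z a y 0; rewrite br3_02 !addr0. Qed.
Lemma br3Z3 a x y z : [lie x, y, a *: z] = a *: [lie x, y, z] :> L.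
Proof. by have:= br3_linear3 x y a z 0; rewrite br3_03 !addr0. Qed.

Lemma br3N1 x y z : [lie - x, y, z] = - [lie x, y, z] :> L.
Proof. by rewrite -scaleN1r br3Z1 scaleN1r. Qed.
Lemma br3N2 x y z : [lie x, - y, z] = - [lie x, y, z] :> L.
Proof. by rewrite -scaleN1r br3Z2 scaleN1r. Qed.
Lemma br3N3 x y z : [lie x, y, - z] = - [lie x, y, z] :> L.
Proof. by rewrite -scaleN1r br3Z3 scaleN1r. Qed.

Definition br3E := (br3D1, br3D2, br3D3, br3N1, br3N2, br3N3, br3Z1, br3Z2,
  br3Z3, br3_01, br3_02, br3_03).

End Lie3Defs.

(* The space b = F e_1 + F e_2 and its dual; the bracket of b is zero. *)
Notation plane F := 'rV[F]_2.
Notation plane_dual F := 'Hom('rV[F]_2, F^o).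

Section Plane.
Variable F : fieldType.

Definition plane_e (i : 'I_2) : plane F := delta_mx 0 i.

Definition plane_coord (i : 'I_2) (y : 'rV[F]_2) : F^o := y 0 i.

Fact plane_coord_linear i : linear (plane_coord i).
Proof. by move=> a u v; rewrite /plane_coord !mxE. Qed.
HB.instance Definition _ i :=
  GRing.isLinear.Build F 'rV[F]_2 F^o _ (plane_coord i) (plane_coord_linear i).

Definition plane_edual (i : 'I_2) : plane_dual F := linfun (plane_coord i).

Lemma plane_edualE i j : plane_edual i (plane_e j) = (i == j)%:R.
Proof. by rewrite lfunE /= /plane_coord mxE eqxx. Qed.

(* Coordinate of y /\ z on the generator e_1 /\ e_2 of the exterior square. *)
Definition plane_wedge (y z : plane F) : F :=
  y 0 0 * z 0 1 - y 0 1 * z 0 0.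

Lemma plane_wedge_e : plane_wedge (plane_e 0) (plane_e 1) = 1.
Proof. by rewrite /plane_wedge !mxE /= mulr0 mulr1 subr0. Qed.

Lemma plane_wedgeNC y z : plane_wedge z y = - plane_wedge y z.
Proof. by rewrite /plane_wedge; ring. Qed.

Lemma plane_wedge_linearr y : linear (plane_wedge y : _ -> F^o).
Proof.
move=> a u v; rewrite /plane_wedge !mxE.
by rewrite /GRing.scale /=; ring.
Qed.

Lemma plane_wedge_linearl z : linear (plane_wedge ^~ z : _ -> F^o).
Proof.
move=> a u v; rewrite /plane_wedge !mxE.
by rewrite /GRing.scale /=; ring.
Qed.

End Plane.

Section DoubleExtensionMaps.
Variables (F : fieldType) (A : lie3Type F).
Variables (B : {biscalar A}) (delta : {linear A -> A}).

Definition dext_psi (y z : plane F) (x : A) : A :=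
  plane_wedge y z *: delta x.

Lemma dext_psi_e x : dext_psi (plane_e F 0) (plane_e F 1) x = delta x.
Proof. by rewrite /dext_psi plane_wedge_e scale1r. Qed.

Definition dext_phi_fun (x1 x2 : A) (y : plane F) (z : 'rV[F]_2) : F^o :=
  B (dext_psi y z x1) x2.

Fact dext_phi_linear x1 x2 y : linear (dext_phi_fun x1 x2 y).
Proof.
move=> a u v; rewrite /dext_phi_fun /dext_psi plane_wedge_linearr.
by rewrite scalerDl linearDl -scalerA linearZl_LR.
Qed.
HB.instance Definition _ x1 x2 y := GRing.isLinear.Build F 'rV[F]_2 F^o _
  (dext_phi_fun x1 x2 y) (dext_phi_linear x1 x2 y).

Definition dext_phi (x1 x2 : A) (y : plane F) : plane_dual F :=
  linfun (dext_phi_fun x1 x2 y).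

Lemma dext_phiE x1 x2 y z : dext_phi x1 x2 y z = B (dext_psi y z x1) x2.
Proof. by rewrite lfunE. Qed.

End DoubleExtensionMaps.

(* dext carries the hypotheses on B and delta as phantom arguments so that its
   3-Lie structure can be inferred from the type; an element of b + A + b^* is a
   triple (y, x, f). *)
Section DoubleExtension.
Variables (F : fieldType) (A : lie3Type F) (B : {biscalar A}).
Variable delta : {linear A -> A}.
Hypothesis Bmetric : is_metric B.
Hypothesis deltaDer : is_Der B delta.
Hypothesis delta_br : forall x y z : A, delta [lie x, y, z] = 0.

Definition dext of is_metric B & is_Der B delta
  & (forall x y z : A, delta [lie x, y, z] = 0) : Type :=
  (plane F * A * plane_dual F)%type.

Local Notation At := (dext Bmetric deltaDer delta_br).

HB.instance Definition _ := GRing.Lmodule.copy At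
  (plane F * A * plane_dual F)%type.

Definition dext_inb (y : plane F) : At := (y, 0, 0).
Definition dext_inA (x : A) : At := (0, x, 0).
Definition dext_inbdual (f : plane_dual F) : At := (0, 0, f).

Definition dext_bracket (u1 u2 u3 : At) : At :=
  let: (y1, x1, f1) := u1 in
  let: (y2, x2, f2) := u2 in
  let: (y3, x3, f3) := u3 in
  (0,
   [lie x1, x2, x3] + dext_psi delta y2 y3 x1 - dext_psi delta y1 y3 x2
     + dext_psi delta y1 y2 x3,
   dext_phi B delta x1 x2 y3 - dext_phi B delta x1 x3 y2
     + dext_phi B delta x2 x3 y1).

Definition dext_form (u1 u2 : At) : F :=
  let: (y1, x1, f1) := u1 in
  let: (y2, x2, f2) := u2 in
  B x1 x2 + f1 y2 + f2 y1.

Let BD1 u v w : B (u + v) w = B u w + B v w. Proof. exact: linearDl. Qed.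
Let BD2 u v w : B u (v + w) = B u v + B u w. Proof. exact: linearDr. Qed.
Let BN1 u v : B (- u) v = - B u v. Proof. exact: linearNl. Qed.
Let BN2 u v : B u (- v) = - B u v. Proof. exact: linearNr. Qed.
Let BZ1 a u v : B (a *: u) v = a * B u v. Proof. exact: linearZl_LR. Qed.
Let BZ2 a u v : B u (a *: v) = a * B u v. Proof. exact: linearZr_LR. Qed.
Let B01 u : B 0 u = 0. Proof. exact: linear0l. Qed.
Let B02 u : B u 0 = 0. Proof. exact: linear0r. Qed.
Let BE := (BD1, BD2, BN1, BN2, BZ1, BZ2, B01, B02).

Let dD u v : delta (u + v) = delta u + delta v. Proof. exact: linearD. Qed.
Let dN u : delta (- u) = - delta u. Proof. exact: linearN. Qed.
Let dZ a u : delta (a *: u) = a *: delta u. Proof. exact: linearZ. Qed.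
Let d0 : delta 0 = 0. Proof. exact: linear0. Qed.

Let Bext x y : (forall t, B x t = B y t) -> x = y.
Proof.
move=> e; apply/eqP; rewrite -subr_eq0; apply/eqP.
by apply: (metric_nondeg Bmetric) => t; rewrite !BE e subrr.
Qed.

Let Bskew x y : B x (delta y) = - B (delta x) y.
Proof. by have /eqP := deltaDer.2 x y; rewrite addrC addr_eq0 => /eqP. Qed.

Let Bskew' x y : B (delta y) x = - B (delta x) y.
Proof. by rewrite -Bskew (metric_sym Bmetric). Qed.

Let br3_delta3 x y z : [lie x, y, delta z] = 0.
Proof.
apply: Bext => t; rewrite B01; have /eqP := metric_inv Bmetric x y (delta z) t.
rewrite addr_eq0 => /eqP ->; apply/eqP; rewrite oppr_eq0; apply/eqP.
by rewrite (metric_sym Bmetric) Bskew delta_br B01 oppr0.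
Qed.

Let br3_delta2 x y z : [lie x, delta y, z] = 0.
Proof. by rewrite br3_skew23 br3_delta3 oppr0. Qed.

Let br3_delta1 x y z : [lie delta x, y, z] = 0.
Proof. by rewrite br3_skew12 br3_delta2 oppr0. Qed.

Let dext_eq (u v : At) :
  (forall i, u.1.1 0 i = v.1.1 0 i) -> (forall t, B u.1.2 t = B v.1.2 t) ->
  (forall z, u.2 z = v.2 z) -> u = v.
Proof.
case: u v => [[y x] f] [[y' x'] f'] /= ey /Bext -> /lfunP ->.
by suff -> : y = y' by []; apply/matrixP => i j; rewrite ord1.
Qed.

Let dE := (dD, dN, dZ, d0, delta_br, br3_delta1, br3_delta2, br3_delta3).
Let lE := (add_lfunE, opp_lfunE, scale_lfunE, zero_lfunE, dext_phiE).

Let Bdelta_br u x y z : B (delta u) [lie x, y, z] = 0.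
Proof. by rewrite -[LHS]opprK -Bskew delta_br B02 oppr0. Qed.

Let Bdelta2 x y : B (delta (delta x)) y = - B (delta x) (delta y).
Proof. by rewrite Bskew opprK. Qed.

Let QC y x : B (delta x) (delta y) = B (delta y) (delta x).
Proof. exact: metric_sym. Qed.

Ltac dext_norm := rewrite /=; intros;
  rewrite ?lE /dext_psi /plane_wedge ?(mxE, BE, dE, br3E) /GRing.scale /= .

Fact dext_linear1 v w : linear (fun u => dext_bracket u v w).
Proof.
move: v w => [[y2 x2] f2] [[y3 x3] f3] a [[y x] f] [[y' x'] f'].
by apply: dext_eq; dext_norm; ring.
Qed.

Fact dext_linear2 u w : linear (fun v => dext_bracket u v w).
Proof.
move: u w => [[y2 x2] f2] [[y3 x3] f3] a [[y x] f] [[y' x'] f'].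
by apply: dext_eq; dext_norm; ring.
Qed.

Fact dext_linear3 u v : linear (fun w => dext_bracket u v w).
Proof.
move: u v => [[y2 x2] f2] [[y3 x3] f3] a [[y x] f] [[y' x'] f'].
by apply: dext_eq; dext_norm; ring.
Qed.

Fact dext_skew12 u v w : dext_bracket v u w = - dext_bracket u v w.
Proof.
move: u v w => [[y1 x1] f1] [[y2 x2] f2] [[y3 x3] f3].
apply: dext_eq; dext_norm; rewrite ?(br3_skew12 x1) ?(Bskew' x1 x2) ?BE;
  by ring.
Qed.

Fact dext_skew23 u v w : dext_bracket u w v = - dext_bracket u v w.
Proof.
move: u v w => [[y1 x1] f1] [[y2 x2] f2] [[y3 x3] f3].
apply: dext_eq; dext_norm; rewrite ?(br3_skew23 _ x2) ?(Bskew' x2 x3) ?BE;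
  by ring.
Qed.

Fact dext_fundamental u1 u2 u3 v2 v3 :
  dext_bracket (dext_bracket u1 u2 u3) v2 v3 =
    dext_bracket (dext_bracket u1 v2 v3) u2 u3
    + dext_bracket u1 (dext_bracket u2 v2 v3) u3
    + dext_bracket u1 u2 (dext_bracket u3 v2 v3).
Proof.
move: u1 u2 u3 v2 v3 => [[y1 x1] f1] [[y2 x2] f2] [[y3 x3] f3]
  [[y4 x4] f4] [[y5 x5] f5].
apply: dext_eq.
- by move=> i /=; rewrite !mxE !addr0.
- dext_norm; rewrite (br3_fundamental x1 x2 x3 x4 x5) !BE.
  move: (B [lie [lie x1, x4, x5], x2, x3] t) (B [lie x1, [lie x2, x4, x5], x3]
    t)
    (B [lie x1, x2, [lie x3, x4, x5]] t) (B (delta (delta x1)) t)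
    (B (delta (delta x2)) t) (B (delta (delta x3)) t) (B (delta (delta x4)) t)
    (B (delta (delta x5)) t).
  move: (y1 0 0) (y1 0 1) (y2 0 0) (y2 0 1) (y3 0 0) (y3 0 1) (y4 0 0) (y4 0 1)
    (y5 0 0) (y5 0 1) => *.
  ring.
- dext_norm; rewrite !Bdelta_br !Bdelta2.
  rewrite ?(QC x1 x2) ?(QC x1 x3) ?(QC x1 x4) ?(QC x1 x5) ?(QC x2 x3) ?(QC x2
    x4) ?(QC x2 x5) ?(QC x3 x4) ?(QC x3 x5) ?(QC x4 x5).
  rewrite ?(mulr0, mul0r, oppr0, addr0, add0r, subr0, sub0r).
  move: (B (delta x1) (delta x2)) (B (delta x1) (delta x3)) (B (delta x1) (delta
    x4)) (B (delta x1) (delta x5)) (B (delta x2) (delta x3)) (B (delta x2)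
    (delta x4)) (B (delta x2) (delta x5)) (B (delta x3) (delta x4)) (B (delta
    x3) (delta x5)) (B (delta x4) (delta x5)).
  move: (y1 0 0) (y1 0 1) (y2 0 0) (y2 0 1) (y3 0 0) (y3 0 1) (y4 0 0) (y4 0 1)
    (y5 0 0) (y5 0 1) (z 0 0) (z 0 1) => *.
  ring.
Qed.

HB.instance Definition _ := isLie3.Build F At dext_linear1 dext_linear2
  dext_linear3 dext_skew12 dext_skew23 dext_fundamental.

Let fP (f : plane_dual F) a y y' : f (a *: y + y') = a * f y + f y' :> F.
Proof. by rewrite linearD linearZ. Qed.

Fact dext_form_bilinear : bilinear_for
  (GRing.Scale.Law.clone _ _ *%R _) (GRing.Scale.Law.clone _ _ *%R _) dext_form.
Proof.
by split=> [[[y x] f]|[[y x] f]] a [[y1 x1] f1] [[y2 x2] f2];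
  rewrite /= !fP !BE !lE /GRing.scale /=; ring.
Qed.

HB.instance Definition _ := bilinear_isBilinear.Build F At At F _ _
  dext_form dext_form_bilinear.

Definition dext_metric : {biscalar At} := dext_form.

Lemma dext_metricP : is_metric dext_metric.
Proof.
split.
- move=> [[y1 x1] f1] [[y2 x2] f2]; rewrite /= (metric_sym Bmetric).
  by rewrite -!addrA [f1 _ + _]addrC.
- move=> [[y x] f] e.
  have xE : x = 0.
    by apply: (metric_nondeg Bmetric) => t; have := e (0, t, 0);
      rewrite /= linear0 zero_lfunE !addr0.
  have yE : y = 0.
    apply/matrixP => i j; rewrite ord1 mxE.
    have := e (0, 0, plane_edual F j).
    by rewrite /= B02 linear0 lfunE !add0r.
  have fE : f = 0.
    apply/lfunP => t; rewrite zero_lfunE.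
    by have := e (t, 0, 0); rewrite /= zero_lfunE B02 add0r addr0.
  by rewrite xE yE fE.
- move=> [[y1 x1] f1] [[y2 x2] f2] [[y3 x3] f3] [[y4 x4] f4].
  rewrite /br3 /=; dext_norm; rewrite !linear0.
  rewrite (metric_sym Bmetric x3 (delta x1)) (metric_sym Bmetric x3 (delta x2)).
  rewrite (Bskew x3 x4) -[B x3 _](addKr (B [lie x1, x2, x3] x4)).
  by rewrite (metric_inv Bmetric); ring.
Qed.

(* D, -1 on b and 1 on b^* glue to a linear endomorphism of the double
   extension. *)
Lemma dext_end_exists (D : {linear A -> A}) :
  exists Dt : {linear At -> At},
    [/\ forall x : A, Dt (dext_inA x) = dext_inA (D x),
        forall i, Dt (dext_inb (plane_e F i)) = - dext_inb (plane_e F i)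
      & forall i, Dt (dext_inbdual (plane_edual F i))
                  = dext_inbdual (plane_edual F i)].
Proof.
pose g (u : At) : At := (- u.1.1, D u.1.2, u.2).
have gL : linear g.
  move=> a [[y x] f] [[y' x'] f']; rewrite /g /= (linearP D).
  by have -> : - (a *: y + y') = a *: - y - y' by rewrite opprD scalerN.
pose gI := GRing.isLinear.Build F At At _ g gL.
exists (HB.pack_for {linear At -> At} g gI).
split=> [x|i|i]; rewrite /= /g /= ?(linear0 D) ?oppr0 //.
have -> : - dext_inb (plane_e F i) = (- plane_e F i, - 0, - 0) by [].
by rewrite !oppr0.
Qed.

End DoubleExtension.

(* Main.v *)
Require Import Defs.
From HB Require Import structures.
From mathcomp Require Import all_boot all_order all_algebra.
From mathcomp Require Import ring.

Set Implicit Arguments.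
Unset Strict Implicit.
Unset Printing Implicit Defensive.

Import GRing.Theory.
Local Open Scope ring_scope.

(** The values prescribed on [A] and on the two dual bases force the
    endomorphism to be [(y, x, f) |-> (- y, D x, f)] ([dext_endE]), which is
    visibly bijective when [D] is.

    It is skew for the metric because [D] is skew on [A] and because the scalars
    [-1] on [b] and [1] on [b^*] are opposite, so that their contributions to
    the pairing of [b] with [b^*] cancel.

    The derivation rule holds for each of the three maps that make up the
    bracket.  For the bracket of [A] it is the hypothesis on [D].  For
    [(y, z, x) |-> psi y z x], the arguments [y] and [z] together contribute the
    scalar [-2], which the relation [delta D - D delta = 2 delta] compensates
    ([dext_psi_der]).  For [phi], pairing that relation with [B], in which [D] is
    skew, gives [B (delta (D x1)) x2 + B (delta x1) (D x2)
    = 2 * B (delta x1) x2]; the argument in [b] lowers the scalar from [2] to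
    [1], which is the scalar on [b^*] ([dext_phi_der]).  The bracket is a
    signed sum of these maps, hence obeys the rule as well. *)

Section DoubleExtensionDerivation.
Variables (F : fieldType) (A : lie3Type F) (B : {biscalar A}).
Variables (D delta : {linear A -> A}).
Hypothesis DDer : is_Der B D.
Hypothesis delta_D : forall x, delta (D x) - D (delta x) = 2%:R *: delta x.

(** The two arguments in [b] contribute [-2], the defect of commutation. *)
Lemma dext_psi_der y z x :
  D (dext_psi delta y z x) = dext_psi delta y z (D x)
    + dext_psi delta (- y) z x + dext_psi delta y (- z) x.
Proof.
have wN1 : plane_wedge (- y) z = - plane_wedge y z.
  by rewrite /plane_wedge !mxE; ring.
have wN2 : plane_wedge y (- z) = - plane_wedge y z.
  by rewrite /plane_wedge !mxE; ring.
rewrite /dext_psi wN1 wN2 linearZ /=.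
have -> : D (delta x) = delta (D x) - 2%:R *: delta x.
  by rewrite -delta_D opprB addrC subrK.
by rewrite scalerBr scaler_nat mulr2n scalerDr opprD addrA !scaleNr.
Qed.

(** The left side carries no map because [b^*] is acted upon by the identity:
    [D] contributes [2] through the two arguments in [A], and [y]
    contributes [-1]. *)
Lemma dext_phi_der x1 x2 y :
  dext_phi B delta x1 x2 y = dext_phi B delta (D x1) x2 y
    + dext_phi B delta x1 (D x2) y + dext_phi B delta x1 x2 (- y).
Proof.
have BdD : B (delta (D x1)) x2 + B (delta x1) (D x2) = 2%:R * B (delta x1) x2.
  rewrite -linearZl_LR -delta_D linearBl.
  have /eqP := DDer.2 (delta x1) x2.
  by rewrite addrC addr_eq0 => /eqP ->.
apply/lfunP => z; rewrite !add_lfunE !dext_phiE /dext_psi.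
have -> : plane_wedge (- y) z = - plane_wedge y z.
  by rewrite /plane_wedge !mxE; ring.
rewrite !linearZl_LR /= -mulrDr BdD; ring.
Qed.

Hypothesis Bmetric : is_metric B.
Hypothesis deltaDer : is_Der B delta.
Hypothesis delta_br : forall x y z : A, delta [lie x, y, z] = 0.

Local Notation At := (dext Bmetric deltaDer delta_br).
Local Notation inb := (dext_inb Bmetric deltaDer delta_br).
Local Notation inA := (dext_inA Bmetric deltaDer delta_br).
Local Notation inbdual := (dext_inbdual Bmetric deltaDer delta_br).

Lemma dext_addE y y' x x' f f' :
  ((y, x, f) : At) + (y', x', f') = (y + y', x + x', f + f').
Proof. by []. Qed.

Lemma dext_br3E (y1 y2 y3 : plane F) (x1 x2 x3 : A) (f1 f2 f3 : plane_dual F) :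
  [lie (y1, x1, f1) : At, (y2, x2, f2) : At, (y3, x3, f3) : At]
  = (0, [lie x1, x2, x3] + dext_psi delta y2 y3 x1 - dext_psi delta y1 y3 x2
       + dext_psi delta y1 y2 x3,
     dext_phi B delta x1 x2 y3 - dext_phi B delta x1 x3 y2
       + dext_phi B delta x2 x3 y1).
Proof. by []. Qed.

Let inb_linear : linear inb.
Proof.
move=> a y y'; rewrite /dext_inb.
have -> : a *: ((y, 0, 0) : At) + ((y', 0, 0) : At)
    = (a *: y + y', a *: 0 + 0, a *: 0 + 0) by [].
by rewrite !scaler0 !addr0.
Qed.
HB.instance Definition _ := GRing.isLinear.Build F _ At _ inb inb_linear.

Let inbdual_linear : linear inbdual.
Proof.
move=> a f f'; rewrite /dext_inbdual.
have -> : a *: ((0, 0, f) : At) + ((0, 0, f') : At)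
    = (a *: 0 + 0, a *: 0 + 0, a *: f + f') by [].
by rewrite !scaler0 !addr0.
Qed.
HB.instance Definition _ :=
  GRing.isLinear.Build F _ At _ inbdual inbdual_linear.

Lemma plane_dual_sum_edual (f : plane_dual F) :
  f = \sum_(i < 2) f (plane_e F i) *: plane_edual F i.
Proof.
apply/lfunP => y; rewrite sum_lfunE {1}(row_sum_delta y) linear_sum /=.
apply: eq_bigr => i _; rewrite linearZ /= scale_lfunE lfunE /=.
exact: mulrC.
Qed.

Variable Dt : {linear At -> At}.
Hypothesis Dt_A : forall x, Dt (inA x) = inA (D x).
Hypothesis Dt_e : forall i, Dt (inb (plane_e F i)) = - inb (plane_e F i).
Hypothesis Dt_edual : forall i,
  Dt (inbdual (plane_edual F i)) = inbdual (plane_edual F i).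

Lemma dext_endE y x f : Dt (y, x, f) = (- y, D x, f).
Proof.
have Dt_b : Dt (inb y) = inb (- y).
  rewrite [RHS]linearN (row_sum_delta y) !linear_sum /=.
  by apply: eq_bigr => i _; rewrite !linearZ /= Dt_e scalerN.
have Dt_bdual : Dt (inbdual f) = inbdual f.
  rewrite (plane_dual_sum_edual f) !linear_sum.
  by apply: eq_bigr => i _; rewrite !linearZ /= Dt_edual.
have dec y' x' f' : ((y', x', f') : At) = inb y' + inA x' + inbdual f'.
  by rewrite !dext_addE !addr0 !add0r.
by rewrite dec !linearD Dt_b Dt_A Dt_bdual -dec.
Qed.

Lemma dext_end_bij : bijective D -> bijective Dt.
Proof.
case=> D' DK D'K.
exists (fun u : At => (- u.1.1, D' u.1.2, u.2)) => -[[y x] f];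
  by rewrite dext_endE /= opprK ?DK ?D'K.
Qed.

Lemma dext_end_derivation : is_derivation Dt.
Proof.
move=> [[y1 x1] f1] [[y2 x2] f2] [[y3 x3] f3].
rewrite dext_br3E !dext_endE !dext_br3E !dext_addE.
congr (_, _, _); first by rewrite oppr0 !addr0.
  rewrite !linearD linearN /= DDer.1 !dext_psi_der !opprD !addrA.
  (* The twelve terms, regrouped by the argument that is acted upon. *)
  by rewrite [LHS](ACl (1*4*8*11*2*5*7*12*3*6*9*10)).
rewrite (dext_phi_der x1 x2) (dext_phi_der x1 x3) (dext_phi_der x2 x3).
by rewrite !opprD !addrA [LHS](ACl (1*4*9*2*6*7*3*5*8)).
Qed.

Lemma dext_end_skew u v :
  dext_metric Bmetric deltaDer delta_br (Dt u) v
    + dext_metric Bmetric deltaDer delta_br u (Dt v) = 0.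
Proof.
move: u v => [[y1 x1] f1] [[y2 x2] f2].
rewrite !dext_endE /= !linearN /=.
have -> : B x1 (D x2) = - B (D x1) x2.
  by have /eqP := DDer.2 x1 x2; rewrite addrC addr_eq0 => /eqP.
by ring.
Qed.

End DoubleExtensionDerivation.

Theorem theorem4p9
  (F : closedFieldType) (charF0 : [pchar F] =i pred0)
  (A : lie3Type F) (B : {biscalar A}) (Bmetric : is_metric B)
  (D : {linear A -> A}) (DDer : is_Der B D) (Dinv : bijective D)
  (delta : {linear A -> A}) (deltaDer : is_Der B delta)
  (delta_br : forall x y z : A, delta [lie x, y, z] = 0)
  (delta_D : forall x : A, delta (D x) - D (delta x) = 2%:R *: delta x)
  (Dt : {linear dext Bmetric deltaDer delta_br
                -> dext Bmetric deltaDer delta_br})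
  (Dt_A : forall x : A, Dt (dext_inA Bmetric deltaDer delta_br x)
            = dext_inA Bmetric deltaDer delta_br (D x))
  (Dt_e : forall i : 'I_2,
     Dt (dext_inb Bmetric deltaDer delta_br (plane_e F i))
       = - dext_inb Bmetric deltaDer delta_br (plane_e F i))
  (Dt_edual : forall i : 'I_2,
     Dt (dext_inbdual Bmetric deltaDer delta_br (plane_edual F i))
       = dext_inbdual Bmetric deltaDer delta_br (plane_edual F i)) :
  [/\ bijective Dt,
      is_derivation Dt
    & is_Der (dext_metric Bmetric deltaDer delta_br) Dt].
Proof.
have der := dext_end_derivation DDer delta_D Dt_A Dt_e Dt_edual.
split=> //; first exact: dext_end_bij Dt_A Dt_e Dt_edual Dinv.
by split=> // u v; exact: (dext_end_skew DDer Dt_A Dt_e Dt_edual).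
Qed.
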